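(* Let $n\geq k\geq 2$ be integers and let $q$ be an integer with $0\leq q\leq k$. The homology of the chain complex $\mathcal{C}^{\mathbb{Z}_k,q}$ satisfies \[ H_i(\mathcal{C}^{\mathbb{Z}_k,q})\cong \begin{cases} \mathbb{Z}^{\binom{n}{i}},& \text{ if } 0\leq i\leq n-q-1, \\ 0,& \text{ if } i<0\text{ or }i>n-q. \end{cases} \]
   Context: Fix integers $n\ge k\ge 2$. Let $C_k$ be the cycle graph with $k$ vertices $V=\{v_1,\dots,v_k\}$ and $k$ edges $E=\{e_1,\dots,e_k\}$, both indexed by $\mathbb{Z}_k$, where $e_j$ has endpoints $v_j$ and $v_{j+1}$ (indices mod $k$; for $k=2$ there are two parallel edges). A vertex-edge $n$-tuple is $\sigma=(\sigma_1,\dots,\sigma_n)$ with all $\sigma_i\in V\cup E$. Its vertex support is $\mathrm{supp}_V(\sigma)=\{i\in\mathbb{Z}_k \mid v_i\in\{\sigma_1,\dots,\sigma_n\}\}$ and its dimension is $\dim\sigma=|\{i\mid \sigma_i\in E\}|$. For $P\subseteq\mathbb{Z}_k$ and an integer $0\le q\le |P|$, the chain complex $\mathcal{C}^{P,q}=(C^{P,q}_*,\partial_* )$ of free abelian groups is defined as follows. $C^{P,q}_d$ is freely generated by the vertex-edge $n$-tuples $\sigma$ with $\dim\sigma=d$, $\mathrm{supp}_V(\sigma)\subseteq P$ and $|\mathrm{supp}_V(\sigma)|\geq q$. The boundary $\partial\sigma$ is the signed sum of all tuples obtained from $\sigma$ by replacing one entry $\sigma_i\in E$ by one of its endpoints whose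 index lies in $P$, with the usual cubical signs: if $\sigma_i=e_j$, then replacing it by $v_{j+1}$ (if $j+1\in P$) has coefficient $(-1)^{\rho(\sigma,i)}$ and replacing it by $v_j$ (if $j\in P$) has coefficient $-(-1)^{\rho(\sigma,i)}$, where $\rho(\sigma,i)=|\{m<i\mid\sigma_m\in E\}|$. *)

(* Defs.v *)
From HB Require Import structures.
From mathcomp Require Import all_boot all_order all_algebra.
From mathcomp Require Import boolp zify.

Set Implicit Arguments.
Unset Strict Implicit.
Unset Printing Implicit Defensive.

Import Order.TTheory GRing.Theory Num.Theory.
Local Open Scope ring_scope.

(* Homology of A --f--> B --g--> C at B, as the quotient of the group of cycles
   {x : B | g x = 0} by the subgroup of those cycles that lie in the image
   of f. *)

Definition is_cycle (B C : zmodType) (g : {additive B -> C}) : {pred B} :=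
  [pred x | g x == 0].

Fact is_cycle_zmod_closed (B C : zmodType) (g : {additive B -> C}) :
  zmod_closed (is_cycle g).
Proof.
split=> [|x y]; rewrite !inE ?raddf0 ?eqxx // => /eqP gx /eqP gy.
by rewrite raddfB gx gy subrr.
Qed.

HB.instance Definition _ (B C : zmodType) (g : {additive B -> C}) :=
  GRing.isZmodClosed.Build B (is_cycle g) (is_cycle_zmod_closed g).

Record cycles (B C : zmodType) (g : {additive B -> C}) :=
  Cycle { cycle_val : B; _ : cycle_val \in is_cycle g }.

HB.instance Definition _ (B C : zmodType) (g : {additive B -> C}) :=
  [isSub for @cycle_val B C g].
HB.instance Definition _ (B C : zmodType) (g : {additive B -> C}) :=
  [Choice of cycles g by <:].
HB.instance Definition _ (B C : zmodType) (g : {additive B -> C}) :=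
  [SubChoice_isSubZmodule of cycles g by <:].

Definition is_boundary (A B C : zmodType) (f : {additive A -> B})
    (g : {additive B -> C}) : {pred cycles g} :=
  [pred z : cycles g | `[< exists y : A, f y = val z >]].
Arguments is_boundary {A B C} f g _.

Fact is_boundary_zmod_closed (A B C : zmodType) (f : {additive A -> B})
  (g : {additive B -> C}) : zmod_closed (is_boundary f g).
Proof.
split=> [|x y].
  by rewrite inE; apply/asboolP; exists 0; rewrite raddf0 raddf0.
rewrite !inE => /asboolP[x' fx'] /asboolP[y' fy'].
by apply/asboolP; exists (x' - y'); rewrite raddfB fx' fy' -raddfB.
Qed.

HB.instance Definition _ (A B C : zmodType) (f : {additive A -> B})
    (g : {additive B -> C}) :=
  GRing.isZmodClosed.Build (cycles g) (is_boundary f g)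
    (is_boundary_zmod_closed f g).

Definition homology (A B C : zmodType) (f : {additive A -> B})
  (g : {additive B -> C}) : zmodType := Quotient.quot (is_boundary f g).

Definition zmod_isomorphic (U V : zmodType) : Prop :=
  exists f : {additive U -> V}, bijective f.

(* The entries of a vertex-edge tuple: [inl j] is the vertex v_j and [inr j]
   the edge e_j, with endpoints v_j and v_(j + 1).  The index type 'Z_k is the
   ring Z/k only for k >= 2. *)
Definition site (k : nat) : finType := ('Z_k + 'Z_k)%type.

Definition is_edge (k : nat) (x : site k) : bool :=
  if x is inr _ then true else false.

Definition vesupp (n k : nat) (s : n.-tuple (site k)) : {set 'Z_k} :=
  [set j | inl j \in s].

Definition vedim (n k : nat) (s : n.-tuple (site k)) : nat :=
  #|[set i : 'I_n | is_edge (tnth s i)]|.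

Definition verho (n k : nat) (s : n.-tuple (site k)) (i : 'I_n) : nat :=
  #|[set m : 'I_n | (m < i)%N && is_edge (tnth s m)]|.

(* s with its i-th entry replaced by the vertex v_j *)
Definition put_vertex (n k : nat) (s : n.-tuple (site k)) (i : 'I_n)
    (j : 'Z_k) : n.-tuple (site k) :=
  [tuple if m == i then inl j else tnth s m | m < n].

Definition is_cell (n k : nat) (P : {set 'Z_k}) (q : nat) (d : int)
    (s : n.-tuple (site k)) : bool :=
  [&& (vedim s)%:Z == d, vesupp s \subset P & (q <= #|vesupp s|)%N].

Definition cell (n k : nat) (P : {set 'Z_k}) (q : nat) (d : int) : finType :=
  {s : n.-tuple (site k) | is_cell P q d s}.

(* C^{P,q}_d, the free abelian group on a finite set of generators *)
Definition chain (n k : nat) (P : {set 'Z_k}) (q : nat) (d : int) : zmodType :=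
  {ffun cell n P q d -> int}.

(* the generator s of C^{P,q}_d; it is 0 if s is not a generator in degree d *)
Definition gen (n k : nat) (P : {set 'Z_k}) (q : nat) (d : int)
    (s : n.-tuple (site k)) : chain n P q d :=
  [ffun t : cell n P q d => (val t == s)%:R].

(* The differential has independent source and target degrees d and d', to
   avoid casts between C_(d + 1 - 1) and C_d; it is 0 unless d' = d - 1. *)
Definition boundary_gen (n k : nat) (P : {set 'Z_k}) (q : nat) (d' : int)
    (s : n.-tuple (site k)) : chain n P q d' :=
  \sum_(i < n)
    if tnth s i is inr j then
      ((if j + 1 \in P then gen P q d' (put_vertex s i (j + 1)) else 0)
       - (if j \in P then gen P q d' (put_vertex s i j) else 0))
        *~ (-1) ^+ verho s i
    else 0.

Definition boundary (n k : nat) (P : {set 'Z_k}) (q : nat) (d d' : int)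
    (c : chain n P q d) : chain n P q d' :=
  \sum_(s : cell n P q d) boundary_gen P q d' (val s) *~ c s.

Fact boundary_is_zmod_morphism (n k : nat) (P : {set 'Z_k}) (q : nat)
  (d d' : int) : zmod_morphism (@boundary n k P q d d').
Proof.
move=> b c; rewrite /boundary -sumrB; apply: eq_bigr => s _.
by rewrite !ffunE mulrzBr.
Qed.

HB.instance Definition _ (n k : nat) (P : {set 'Z_k}) (q : nat) (d d' : int) :=
  GRing.isZmodMorphism.Build (chain n P q d) (chain n P q d')
    (@boundary n k P q d d') (@boundary_is_zmod_morphism n k P q d d').

Definition complex_homology (n k : nat) (P : {set 'Z_k}) (q : nat) (i : int)
    : zmodType :=
  homology (@boundary n k P q (i + 1) i) (@boundary n k P q i (i - 1)).

Lemma boundary_gen_cell (n k : nat) (P : {set 'Z_k}) (q : nat) (d d' : int)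
    (s : n.-tuple (site k)) :
  boundary d' (gen P q d s) =
  if is_cell P q d s then boundary_gen P q d' s else 0.
Proof.
have gE t : gen P q d s t = (val t == s)%:R by rewrite ffunE.
rewrite /boundary; case: ifPn => [cs | ncs].
  rewrite (bigD1 (exist _ s cs : cell n P q d)) //= gE eqxx mulr1z.
  rewrite big1 ?addr0 // => t nt; rewrite gE.
  by move: nt; rewrite -val_eqE /= => /negPf->.
apply: big1 => t _; rewrite gE; case: eqP => [ts|//].
by move: ncs; rewrite -ts (valP t : is_cell _ _ _ _).
Qed.

Lemma tnth_put_vertex (n k : nat) (s : n.-tuple (site k)) (i m : 'I_n)
    (j : 'Z_k) :
  tnth (put_vertex s i j) m = if m == i then inl j else tnth s m.
Proof. by rewrite tnth_mktuple. Qed.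

Lemma vedim_put_vertex (n k : nat) (s : n.-tuple (site k)) (i : 'I_n)
    (j : 'Z_k) :
  is_edge (tnth s i) -> vedim s = (vedim (put_vertex s i j)).+1.
Proof.
move=> ei; rewrite /vedim (cardsD1 i) inE ei add1n; congr _.+1.
apply: eq_card => m; rewrite !inE tnth_put_vertex.
by case: eqP.
Qed.

Lemma verho_put_vertex (n k : nat) (s : n.-tuple (site k)) (i m : 'I_n)
    (j : 'Z_k) :
  is_edge (tnth s i) ->
  verho s m = ((i < m)%N + verho (put_vertex s i j) m)%N.
Proof.
move=> ei; rewrite /verho (cardsD1 i) inE ei andbT; congr addn.
apply: eq_card => l; rewrite !inE tnth_put_vertex.
by case: eqP; rewrite ?andbF.
Qed.

Lemma vesupp_put_vertex (n k : nat) (s : n.-tuple (site k)) (i : 'I_n)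
    (j : 'Z_k) :
  is_edge (tnth s i) -> vesupp (put_vertex s i j) = j |: vesupp s.
Proof.
move=> ei; apply/setP => l; rewrite !inE; apply/idP/idP.
  case/tnthP=> m; rewrite tnth_put_vertex; case: eqP => [_ [->]|_ ->].
    by rewrite eqxx.
  by rewrite mem_tnth orbT.
case/orP=> [/eqP->|/tnthP[m sm]]; apply/tnthP.
  by exists i; rewrite tnth_put_vertex eqxx.
exists m; rewrite tnth_put_vertex; case: eqP => // mi.
by rewrite -mi -sm in ei.
Qed.

Lemma put_vertexC (n k : nat) (s : n.-tuple (site k)) (i i' : 'I_n)
    (j j' : 'Z_k) :
  i != i' ->
  put_vertex (put_vertex s i j) i' j' = put_vertex (put_vertex s i' j') i j.
Proof.
move=> ii'; apply: eq_from_tnth => m; rewrite !tnth_put_vertex.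
by case: (eqVneq m i') => [->|//]; rewrite eq_sym (negPf ii').
Qed.

Lemma boundary_genE (n k : nat) (P : {set 'Z_k}) (q : nat) (d' : int)
    (s : n.-tuple (site k)) :
  boundary_gen P q d' s =
  \sum_(p : 'I_n * bool)
    if tnth s p.1 is inr j then
      (if j + p.2%:R \in P then gen P q d' (put_vertex s p.1 (j + p.2%:R))
       else 0) *~ (-1) ^+ (verho s p.1 + ~~ p.2)
    else 0.
Proof.
rewrite -(pair_bigA _ (fun i (b : bool) => if tnth s i is inr j then
      (if j + b%:R \in P then gen P q d' (put_vertex s i (j + b%:R))
       else 0) *~ (-1) ^+ (verho s i + ~~ b) else 0)) /=.
apply: eq_bigr => i _; rewrite big_bool.
case: (tnth s i) => j; first by rewrite /= addr0.
by rewrite /= addn0 addn1 addr0 exprS mulN1r mulrNz mulrzBl.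
Qed.

Lemma boundary_boundary (n k : nat) (P : {set 'Z_k}) (q : nat)
    (d d' d'' : int) (c : chain n P q d) :
  boundary d'' (boundary d' c) = 0.
Proof.
rewrite {2}/boundary raddf_sum big1 // => -[s /= cs] _.
rewrite raddfMz /=; suff -> : boundary d'' (boundary_gen P q d' s) = 0 by rewrite mul0rz.
pose e (p : 'I_n * bool) := if tnth s p.1 is inr j then j + p.2%:R else 0 : 'Z_k.
pose C (p : 'I_n * bool) := is_edge (tnth s p.1) && (e p \in P).
pose G (p p' : 'I_n * bool) : chain n P q d'' :=
  if [&& C p, C p' & p.1 != p'.1] then
    gen P q d'' (put_vertex (put_vertex s p.1 (e p)) p'.1 (e p'))
      *~ ((-1) ^+ (verho s p.1 + ~~ p.2)
          * (-1) ^+ (verho s p'.1 + ~~ p'.2) * (-1) ^+ (p.1 < p'.1)%N)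
  else 0.
have GC p p' : G p p' = - G p' p.
  rewrite /G andbCA [_ == p.1]eq_sym; case: ifP; rewrite ?oppr0 //.
  case/and3P=> _ _ ne; rewrite put_vertexC // -mulrNz; congr (_ *~ _).
  rewrite [X in _ = - (X * _)]mulrC -mulrN; congr (_ * _).
  move: ne; case: ltngtP => [_|_|/val_inj->]; rewrite ?eqxx //=.
have G0 : \sum_p \sum_p' G p p' = 0.
  set S := \sum_p _; have SN : S = - S.
    rewrite {1}/S exchange_big /= -sumrN; apply: eq_bigr => p _.
    by rewrite -sumrN; apply: eq_bigr => p' _.
  apply/ffunP=> t; move/ffunP/(_ t): SN; rewrite !ffunE; lia.
have [dd'|dd'] := boolP ((vedim s)%:Z == d' + 1); last first.
  rewrite boundary_genE raddf_sum big1 // => p _.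
  case E: (tnth s p.1) => [j|j]; first by rewrite raddf0.
  rewrite raddfMz; case: ifP; rewrite ?raddf0 ?mul0rz // => _.
  rewrite /= boundary_gen_cell ifF ?mul0rz //; apply/negP=> /and3P[/eqP dp _ _].
  by move/eqP: dd'; rewrite (@vedim_put_vertex _ _ s p.1 (j + p.2%:R)) ?E // -addn1 PoszD dp.
rewrite boundary_genE raddf_sum -[RHS]G0; apply: eq_bigr => p _.
case E: (tnth s p.1) => [j|j].
  by rewrite raddf0 big1 // => p' _; rewrite /G /C E.
have ep : is_edge (tnth s p.1) by rewrite E.
have je : j + p.2%:R = e p by rewrite /e E.
rewrite je raddfMz; case: ifP => [eP|eP]; last first.
  by rewrite raddf0 mul0rz big1 // => p' _; rewrite /G /C eP andbF.
rewrite /= boundary_gen_cell ifT; last first.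
  case/and3P: cs => _ sP qs; apply/and3P; split.
  - by move: dd'; rewrite (vedim_put_vertex (e p) ep) -addn1 PoszD => /eqP/addIr->.
  - by rewrite vesupp_put_vertex // subUset sub1set eP.
  - rewrite (leq_trans qs) // vesupp_put_vertex //.
    exact/subset_leq_card/subsetUr.
rewrite boundary_genE mulrz_suml; apply: eq_bigr => p' _.
rewrite tnth_put_vertex /G eq_sym.
have [pp'|pp'] := eqVneq p.1 p'.1; first by rewrite !andbF mul0rz.
rewrite andbT {1}/C ep eP /=.
case E': (tnth s p'.1) => [l|l]; first by rewrite /C E' /= mul0rz.
have le : l + p'.2%:R = e p' by rewrite /e E'.
rewrite le /C E' /=; case: ifP; rewrite ?mul0rz // => _.
rewrite -mulrzA mulrC (verho_put_vertex p'.1 (e p) ep) -!mulrA.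
congr (_ *~ (_ * _)); rewrite -exprD; case: (p.1 < p'.1)%N => /=.
  by rewrite addn1 !add1n addSn !exprS !mulN1r opprK.
by rewrite addn0.
Qed.

(* Main.v *)
Require Import Defs.
From HB Require Import structures.
From mathcomp Require Import all_boot all_order all_algebra.
From mathcomp Require Import boolp generic_quotient zify ring.

(** For [P <> Z_k] the one-coordinate complex spanned by the edges and the
    vertices in [P] has no homology in degree 0, so its [n]-th tensor power
    [C^{P,0}] is acyclic in degrees below [n]; for [P = Z_k] the tensor power is
    the cellular complex of the [n]-torus.  Both facts come from contracting one
    coordinate at a time onto a base vertex [v_p]: with [D] the differential and
    [H_m] the contraction of coordinate [m], [1 - (D H_m + H_m D)] acts on
    coordinate [m] only.

    The quotient [C^{P,q} / C^{P,q+1}] is the direct sum of the complexes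
    [C^{S,q}] over [S] contained in [P] with [#|S| = q].  By induction on [#|S|],
    [C^{S,#|S|}] is acyclic in degrees below [n - #|S|] for every proper [S];
    hence each step of the filtration leaves the homology of the torus unchanged
    in degrees below [n - q], and the number of [i]-dimensional coordinate
    subtori is ['C(n, i)]. *)

Set Implicit Arguments.
Unset Strict Implicit.
Unset Printing Implicit Defensive.

Import Order.TTheory GRing.Theory Num.Theory.
Local Open Scope ring_scope.

(** * Operators acting on one coordinate *)

Section Operators.

Variables n k : nat.

Local Notation tup := (n.-tuple (site k)).
Local Notation C := {ffun tup -> int}.

Implicit Types (s t : tup) (f g : C) (m : 'I_n) (x y : site k).

Definition put s m x : tup := [tuple if l == m then x else tnth s l | l < n].

Lemma tnth_put s m x l : tnth (put s m x) l = if l == m then x else tnth s l.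
Proof. by rewrite tnth_mktuple. Qed.

Lemma tnth_put_same s m x : tnth (put s m x) m = x.
Proof. by rewrite tnth_put eqxx. Qed.

Lemma tnth_put_neq s m x l : l != m -> tnth (put s m x) l = tnth s l.
Proof. by rewrite tnth_put => /negPf->. Qed.

Lemma put_put s m x y : put (put s m x) m y = put s m y.
Proof. by apply: eq_from_tnth => l; rewrite !tnth_put; case: eqP. Qed.

Lemma put_id s m : put s m (tnth s m) = s.
Proof. by apply: eq_from_tnth => l; rewrite tnth_put; case: eqP => // ->. Qed.

Lemma putC s m l x y : m != l -> put (put s m x) l y = put (put s l y) m x.
Proof.
move=> ml; apply: eq_from_tnth => j; rewrite !tnth_put.
by case: (eqVneq j l) => [->|//]; rewrite eq_sym (negPf ml).
Qed.

Lemma verho_put_same s m x : verho (put s m x) m = verho s m.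
Proof.
rewrite /verho; apply: eq_card => l; rewrite !inE tnth_put.
by case: eqP => // ->; rewrite ltnn.
Qed.

(** Turning a vertex at [m] into an edge, or back, changes [verho] by one exactly at the coordinates
    after [m]; this is the source of the Koszul signs. *)
Lemma sign_verho_put s m l x :
  m != l -> is_edge x != is_edge (tnth s m) ->
  (-1) ^+ verho (put s m x) l = (-1) ^+ (m < l)%N * (-1) ^+ verho s l :> int.
Proof.
move=> ml xm; rewrite -exprD.
have rho t : verho t l =
    ((m < l) && is_edge (tnth t m)
     + #|[set j : 'I_n | (j != m) && ((j < l) && is_edge (tnth t j))]|)%N.
  by rewrite /verho (cardsD1 m) inE; congr addn; apply: eq_card => j; rewrite !inE.
rewrite !rho tnth_put_same.
rewrite (_ : [set j : 'I_n | _] =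
    [set j : 'I_n | (j != m) && ((j < l)%N && is_edge (tnth s j))]).
  case: (m < l)%N => //=.
  by case: (is_edge x) (is_edge (tnth s m)) xm => [] [] //= _;
    rewrite !exprD ?expr1 ?expr0; ring.
by apply/setP=> j; rewrite !inE tnth_put; case: eqP.
Qed.

Lemma vedim_put s m x :
  (vedim (put s m x) + is_edge (tnth s m) = vedim s + is_edge x)%N.
Proof.
have dE t : vedim t =
    (is_edge (tnth t m) + #|[set j : 'I_n | (j != m) && is_edge (tnth t j)]|)%N.
  by rewrite /vedim (cardsD1 m) inE; congr addn; apply: eq_card => j; rewrite !inE.
rewrite !dE tnth_put_same.
rewrite (_ : [set j : 'I_n | _] = [set j : 'I_n | (j != m) && is_edge (tnth s j)]).
  by lia.
by apply/setP=> j; rewrite !inE tnth_put; case: eqP.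
Qed.

Lemma vesupp_put_edge s m x : is_edge x -> vesupp (put s m x) \subset vesupp s.
Proof.
move=> ex; apply/subsetP=> j; rewrite !inE => /tnthP[l].
by rewrite tnth_put; case: eqP => [_ jx|_ ->]; [rewrite -jx in ex | rewrite mem_tnth].
Qed.

Lemma vesupp_put_edgeK s m x j :
  tnth s m = inl j -> vesupp s \subset j |: vesupp (put s m x).
Proof.
move=> sm; apply/subsetP=> i; rewrite !inE => /tnthP[l].
have [->|lm] := eqVneq l m; first by rewrite sm => -[->]; rewrite eqxx.
by move=> ->; rewrite -(tnth_put_neq s x lm) mem_tnth orbT.
Qed.

Definition smat := site k -> site k -> int.
Implicit Types M N : smat.

Definition smul M N : smat := fun x z => \sum_y M x y * N y z.
Definition sadd M N : smat := fun x y => M x y + N x y.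
Definition sodd M := forall x y, is_edge x = is_edge y -> M x y = 0.

(** Chains are coefficient functions, and [M x y] is the coefficient of [x] in the image of [y]; so
    this is [M] acting on the tensor factor [m]. The variant [oop] carries the Koszul sign needed by
    operators of odd degree. *)
Definition eop M m f : C := [ffun s => \sum_x M (tnth s m) x * f (put s m x)].
Definition oop M m f : C := [ffun s => (-1) ^+ verho s m * eop M m f s].

Fact eop_is_zmod_morphism M m : zmod_morphism (eop M m).
Proof.
move=> f g; apply/ffunP=> s; rewrite !ffunE -sumrB; apply: eq_bigr => x _.
by rewrite !ffunE mulrBr.
Qed.

HB.instance Definition _ M m :=
  GRing.isZmodMorphism.Build C C (eop M m) (@eop_is_zmod_morphism M m).

Fact oop_is_zmod_morphism M m : zmod_morphism (oop M m).
Proof. by move=> f g; apply/ffunP=> s; rewrite ffunE raddfB !ffunE mulrBr. Qed.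

HB.instance Definition _ M m :=
  GRing.isZmodMorphism.Build C C (oop M m) (@oop_is_zmod_morphism M m).

Lemma eop_eop M N m f : eop M m (eop N m f) = eop (smul M N) m f.
Proof.
apply/ffunP=> s; rewrite !ffunE.
under eq_bigr => x _ do rewrite ffunE tnth_put_same mulr_sumr.
rewrite exchange_big; apply: eq_bigr => y _; rewrite mulr_suml.
by apply: eq_bigr => x _; rewrite put_put mulrA.
Qed.

Lemma oop_oop M N m f : oop M m (oop N m f) = eop (smul M N) m f.
Proof.
rewrite -eop_eop; apply/ffunP=> s; rewrite !ffunE mulr_sumr.
apply: eq_bigr => x _; rewrite ffunE verho_put_same.
by rewrite mulrCA; congr (_ * _); rewrite mulrA -expr2 sqrr_sign mul1r.
Qed.

Lemma eop_add M N m f : eop (sadd M N) m f = eop M m f + eop N m f.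
Proof.
apply/ffunP=> s; rewrite !ffunE -big_split; apply: eq_bigr => x _.
by rewrite mulrDl.
Qed.

Lemma eopC M N m l f : m != l -> eop M m (eop N l f) = eop N l (eop M m f).
Proof.
move=> ml; apply/ffunP=> s; rewrite !ffunE.
under eq_bigr => x _ do rewrite ffunE mulr_sumr.
rewrite exchange_big; apply: eq_bigr => y _; rewrite ffunE mulr_sumr.
apply: eq_bigr => x _; rewrite putC // tnth_put_neq 1?eq_sym //.
by rewrite tnth_put_neq // mulrCA.
Qed.

(** The operator at the smaller coordinate flips the sign seen by the other one, and not conversely,
    so the two orders differ by one sign. *)
Lemma oopC M N m l f : sodd M -> sodd N -> m != l ->
  oop M m (oop N l f) = - oop N l (oop M m f).
Proof.
move=> oM oN ml; apply/ffunP=> s; rewrite !ffunE.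
under eq_bigr => x _ do rewrite !ffunE !mulr_sumr.
under [in RHS]eq_bigr => x _ do rewrite !ffunE !mulr_sumr.
rewrite [X in _ * X = _]exchange_big !mulr_sumr -sumrN; apply: eq_bigr => y _.
rewrite !mulr_sumr -sumrN; apply: eq_bigr => x _.
rewrite tnth_put_neq 1?eq_sym // tnth_put_neq // putC //.
(* Oddness leaves only the terms in which both entries change type, where [sign_verho_put]
   applies. *)
have [xm|xm] := eqVneq (is_edge x) (is_edge (tnth s m)).
  by rewrite oM // !(mul0r, mulr0, oppr0).
have [yl|yl] := eqVneq (is_edge y) (is_edge (tnth s l)).
  by rewrite oN // !(mul0r, mulr0, oppr0).
rewrite !sign_verho_put // 1?eq_sym //.
by case: ltngtP ml => [_|_|/val_inj->]; rewrite ?eqxx //= => _; ring.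
Qed.

Lemma oopEn M m f s : oop M m f s != 0 ->
  exists x, M (tnth s m) x != 0 /\ f (put s m x) != 0.
Proof.
rewrite !ffunE mulf_eq0 signr_eq0 /= => nz.
have [x /= nx|/= nx] := pickP (fun x => M (tnth s m) x * f (put s m x) != 0).
  by exists x; apply/andP; rewrite -negb_or -mulf_eq0.
by move: nz; rewrite big1 ?eqxx // => x _; apply/eqP; rewrite -[_ == _]negbK nx.
Qed.

Lemma eq_oop M N m f g s :
  (forall x, M (tnth s m) x * f (put s m x) = N (tnth s m) x * g (put s m x)) ->
  oop M m f s = oop N m g s.
Proof. by move=> E; rewrite !ffunE; congr (_ * _); apply: eq_bigr. Qed.

Lemma eop_id M m f s :
  (forall x, M (tnth s m) x = (x == tnth s m)%:R) -> eop M m f s = f s.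
Proof.
move=> E; rewrite ffunE (bigD1 (tnth s m)) //= E eqxx mul1r put_id.
by rewrite big1 ?addr0 // => x /negPf xm; rewrite E xm mul0r.
Qed.

End Operators.

(** * Differential and contraction *)

Lemma val_Zp_addr1 k (u : 'Z_k) :
  (u + 1 : 'Z_k) = (if u == (Zp_trunc k).+1 :> nat then 0 else u.+1) :> nat.
Proof.
rewrite /= modnDmr addn1; case: eqP => [->|ne]; first by rewrite modnn.
by rewrite modn_small // ltnS; have := ltn_ord u; lia.
Qed.

Lemma Zp_eq_nat k (u v : 'Z_k) : (u == v) = (u == v :> nat).
Proof. by []. Qed.

(* Going around the cycle from [v_p], the edge [e_l] is traversed before the
   vertex [v_j] is reached. *)
Definition precedes k (p l j : 'Z_k) : bool := (val (l - p)%R < val (j - p)%R)%N.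

(** The boundary of the path from [v_p] to [v_j] is [v_j - v_p], read off at the vertex [v_(l + 1)];
    the term at [l + 1 = p] appears where the residue of [l + 1 - p] wraps around to 0. *)
Lemma precedesS_l k (p l j : 'Z_k) :
  (precedes p l j)%:R - (precedes p (l + 1) j)%:R
  = (l + 1 == j)%:R - (l + 1 == p)%:R :> int.
Proof.
rewrite /precedes -[_ == j](inj_eq (addIr (- p))).
rewrite -[_ == p](inj_eq (addIr (- p))) subrr -[l + 1 - p]addrAC; set u := l - p; set v := j - p.
have := val_Zp_addr1 u; rewrite !Zp_eq_nat; have := ltn_ord u; have := ltn_ord v.
set w := nat_of_ord (u + 1) => vK uK; rewrite [val (u + 1)](_ : _ = w) //= => E.
by move: (nat_of_ord u) (nat_of_ord v) w vK uK E => a b c; case: eqP; lia.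
Qed.

(** Moving the end of the path from [v_j] to [v_(j + 1)] appends [e_j], except that reaching [v_p]
    resets the path to the empty one, which subtracts the whole cycle. *)
Lemma precedesS_r k (p l j : 'Z_k) :
  (precedes p l (j + 1))%:R - (precedes p l j)%:R
  = (j == l)%:R - (j + 1 == p)%:R :> int.
Proof.
rewrite /precedes -[_ == l](inj_eq (addIr (- p))) -[_ == p](inj_eq (addIr (- p))).
rewrite subrr -[j + 1 - p]addrAC; set u := j - p; set v := l - p.
have := val_Zp_addr1 u; rewrite !Zp_eq_nat; have := ltn_ord u; have := ltn_ord v.
set w := nat_of_ord (u + 1) => vK uK; rewrite [val (u + 1)](_ : _ = w) //= => E.
by move: (nat_of_ord u) (nat_of_ord v) w vK uK E => a b c; case: eqP; lia.
Qed.

Section Differential.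

Variables n k : nat.

Local Notation tup := (n.-tuple (site k)).
Local Notation C := {ffun tup -> int}.

Implicit Types (s t : tup) (f g : C) (m : 'I_n) (x y : site k).
Implicit Types (P S : {set 'Z_k}) (p : 'Z_k).

(* [dmx P x y] is the coefficient of the site [x] in the boundary of the site
   [y], where vertices outside [P] are discarded. *)
Definition dmx P : smat k := fun x y =>
  match x, y with
  | inl j, inr l => (j \in P)%:R * ((l + 1 == j)%:R - (l == j)%:R)
  | _, _ => 0
  end.

(* The contraction sends [v_j] to the sum of the edges on the path from [v_p]
   to [v_j]. *)
Definition smx p : smat k := fun x y =>
  match x, y with
  | inr l, inl j => (precedes p l j)%:R
  | _, _ => 0
  end.

(** For [P = setT], the matrix [1 - kmx] sends every vertex to [v_p], the edge [e_(p - 1)] to the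
    sum of all edges, and every other edge to 0. *)
Definition kmx P p : smat k :=
  sadd (smul (dmx P) (smx p)) (smul (smx p) (dmx P)).

Lemma sodd_dmx P : sodd (dmx P). Proof. by case=> j [] l. Qed.
Lemma sodd_smx p : sodd (smx p). Proof. by case=> j [] l. Qed.

Lemma big_site (F : site k -> int) :
  \sum_x F x = \sum_j F (inl j) + \sum_j F (inr j).
Proof. by rewrite big_sumType. Qed.

Lemma kmx_ll P p j i :
  kmx P p (inl j) (inl i) = (j \in P)%:R * ((i == j)%:R - (j == p)%:R).
Proof.
rewrite /kmx /sadd [X in _ + X]big1 ?addr0; last by move=> y _; rewrite mul0r.
rewrite /smul big_site big1 ?add0r; last by move=> l _; rewrite mul0r.
under eq_bigr => l _ do rewrite -mulrA.
rewrite -mulr_sumr; congr (_ * _).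
under eq_bigr => l _ do rewrite mulrBl.
rewrite sumrB (bigD1 (j - 1)) //= subrK eqxx mul1r big1 ?addr0; last first.
  by move=> l; rewrite -(inj_eq (addIr 1)) subrK => /negPf->; rewrite mul0r.
rewrite (bigD1 j) //= eqxx mul1r big1 ?addr0; last first.
  by move=> l /negPf->; rewrite mul0r.
by have := precedesS_l p (j - 1) i; rewrite subrK eq_sym.
Qed.

Lemma kmx_rr p l i :
  kmx setT p (inr l) (inr i) = (i == l)%:R - (i + 1 == p)%:R.
Proof.
rewrite /kmx /sadd [X in X + _]big1 ?add0r; last by move=> y _; rewrite mul0r.
rewrite /smul big_site [X in _ + X]big1 ?addr0; last by move=> j _; rewrite mul0r.
under eq_bigr => j _ do rewrite /= in_setT mul1r mulrBr.
rewrite sumrB (bigD1 (i + 1)) //= eqxx mulr1 big1 ?addr0; last first.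
  by move=> j; rewrite eq_sym => /negPf->; rewrite mulr0.
rewrite (bigD1 i) //= eqxx mulr1 big1 ?addr0; last first.
  by move=> j; rewrite eq_sym => /negPf->; rewrite mulr0.
exact: precedesS_r.
Qed.

Lemma kmx_lr P p j l : kmx P p (inl j) (inr l) = 0.
Proof.
rewrite /kmx /sadd /smul !big1 ?addr0 // => -[] i _ /=;
  by rewrite ?mulr0 ?mul0r.
Qed.

Lemma kmx_rl P p j l : kmx P p (inr l) (inl j) = 0.
Proof.
rewrite /kmx /sadd /smul !big1 ?addr0 // => -[] i _ /=;
  by rewrite ?mulr0 ?mul0r.
Qed.

Definition diff P f : C := \sum_m oop (dmx P) m f.

Fact diff_is_zmod_morphism P : zmod_morphism (diff P).
Proof. by move=> f g; rewrite /diff -sumrB; apply: eq_bigr => m _; rewrite raddfB. Qed.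

HB.instance Definition _ P :=
  GRing.isZmodMorphism.Build C C (diff P) (@diff_is_zmod_morphism P).

Lemma ffun_eqN (f : C) : f = - f -> f = 0.
Proof.
move=> E; apply/ffunP=> s; move/ffunP/(_ s)/eqP: E.
by rewrite !ffunE -addr_eq0 -mulr2n mulrn_eq0 => /eqP.
Qed.

(** Distinct coordinates anticommute and each one-coordinate differential squares to zero, so the
    double sum equals its own negative. *)
Lemma diff_diff P f : diff P (diff P f) = 0.
Proof.
apply: ffun_eqN; rewrite /diff.
under eq_bigr => m _ do rewrite raddf_sum.
rewrite {1}exchange_big -sumrN; apply: eq_bigr => m _; rewrite -sumrN.
apply: eq_bigr => l _; have [->|ml] := eqVneq m l; last first.
  by rewrite /= oopC 1?eq_sym //; apply: sodd_dmx.
rewrite /=; suff -> : oop (dmx P) l (oop (dmx P) l f) = 0 by rewrite oppr0.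
rewrite oop_oop; apply/ffunP=> s; rewrite !ffunE big1 // => x _.
rewrite /smul big1 ?mul0r // => y _.
by case: (tnth s l) y x => [?|?] [?|?] [?|?] /=; rewrite ?mulr0 ?mul0r.
Qed.

(** The contraction at [m] anticommutes with the differentials of the other coordinates, so only the
    terms at [m] survive. *)
Lemma diff_homotopy P p m f :
  diff P (oop (smx p) m f) + oop (smx p) m (diff P f) = eop (kmx P p) m f.
Proof.
rewrite /diff raddf_sum -big_split (bigD1 m) //= big1 ?addr0.
  by rewrite !oop_oop eop_add.
move=> l lm; rewrite /= oopC ?addNr //; [exact: sodd_dmx | exact: sodd_smx].
Qed.

(** * Projections homotopic to the identity on cycles *)

Definition proj P p m f : C := f - eop (kmx P p) m f.

Fixpoint projs P p (ms : seq 'I_n) f : C :=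
  if ms is m :: ms' then proj P p m (projs P p ms' f) else f.

Fact proj_is_zmod_morphism P p m : zmod_morphism (proj P p m).
Proof.
move=> f g; rewrite /proj raddfB !opprB [_ - eop _ _ f]addrC addrACA.
by rewrite [- g + _]addrC.
Qed.

HB.instance Definition _ P p m :=
  GRing.isZmodMorphism.Build C C (proj P p m) (@proj_is_zmod_morphism P p m).

Fact projs_is_zmod_morphism P p ms : zmod_morphism (projs P p ms).
Proof. by elim: ms => //= m ms IH f g; rewrite IH raddfB. Qed.

HB.instance Definition _ P p ms :=
  GRing.isZmodMorphism.Build C C (projs P p ms) (@projs_is_zmod_morphism P p ms).

Lemma diff_proj P p m f : diff P (proj P p m f) = proj P p m (diff P f).
Proof.
rewrite /proj raddfB -!diff_homotopy raddfD /= !diff_diff.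
by rewrite raddf0 add0r addr0.
Qed.

Lemma diff_projs P p ms f : diff P (projs P p ms f) = projs P p ms (diff P f).
Proof. by elim: ms => //= m ms IH; rewrite diff_proj IH. Qed.

(** Each summand of [kmx] is a product of two odd matrices, so the two sign changes cancel. *)
Lemma oop_proj P p M m l f : sodd M -> m != l ->
  oop M m (proj P p l f) = proj P p l (oop M m f).
Proof.
move=> oM ml; rewrite /proj raddfB; congr (_ - _).
rewrite /kmx !eop_add raddfD -!oop_oop /=.
have c N g : sodd N -> oop M m (oop N l g) = - oop N l (oop M m g).
  by move=> oN; apply: oopC.
by rewrite !c ?raddfN /= ?opprK //; first [exact: sodd_dmx | exact: sodd_smx].
Qed.

(** If [N] absorbs [kmx] then it kills [proj] at [m]; the projections at other coordinates are
    passed first, since even operators on distinct coordinates commute. *)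
Lemma eop_projs0 P p N m ms f :
  (forall g, eop N m (eop (kmx P p) m g) = eop N m g) -> m \in ms ->
  eop N m (projs P p ms f) = 0.
Proof.
move=> NK; elim: ms => //= l ms IH; rewrite inE.
have [<-|ml] := eqVneq m l => /= [_|mms]; rewrite /proj raddfB /=.
  by rewrite NK subrr.
by rewrite eopC // IH // raddf0 subr0.
Qed.

Lemma eop_kmx_vertex p m f s j : tnth s m = inl j ->
  eop (kmx setT p) m f s
  = f s - (j == p)%:R * \sum_i f (put s m (inl i)).
Proof.
move=> sm; rewrite ffunE sm big_site [X in _ + X]big1 ?addr0; last first.
  by move=> i _; rewrite kmx_lr mul0r.
under eq_bigr => i _ do rewrite kmx_ll in_setT mul1r mulrBl.
rewrite sumrB mulr_sumr; congr (_ - _); rewrite (bigD1 j) //= eqxx mul1r.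
rewrite -sm put_id big1 ?addr0 // => i /negPf ij.
by rewrite ij mul0r.
Qed.

Lemma eop_kmx_edge p m f s l : tnth s m = inr l ->
  eop (kmx setT p) m f s = f s - f (put s m (inr (p - 1))).
Proof.
move=> sm; rewrite ffunE sm big_site big1 ?add0r; last first.
  by move=> i _; rewrite kmx_rl mul0r.
under eq_bigr => i _ do rewrite kmx_rr mulrBl.
rewrite sumrB (bigD1 l) //= eqxx mul1r -sm put_id big1 ?addr0; last first.
  by move=> i /negPf->; rewrite mul0r.
congr (_ - _); rewrite (bigD1 (p - 1)) //= subrK eqxx mul1r big1 ?addr0 //.
by move=> i; rewrite -(inj_eq (addIr 1)) subrK => /negPf->; rewrite mul0r.
Qed.

Lemma eop_kmx_idem p m f :
  eop (kmx setT p) m (eop (kmx setT p) m f) = eop (kmx setT p) m f.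
Proof.
apply/ffunP=> s; case sm: (tnth s m) => [j|l].
  rewrite (eop_kmx_vertex _ _ sm).
  under eq_bigr => i _ do rewrite (eop_kmx_vertex _ _ (tnth_put_same _ _ _)).
  under eq_bigr => i _ do under eq_bigr => h _ do rewrite put_put.
  (* Hence the coefficients of the inner image at the vertices add up to zero, and the correction at
     [v_p] vanishes the second time. *)
  have p1 : \sum_i (i == p)%:R = 1 :> int.
    by rewrite (bigD1 p) //= eqxx big1 ?addr0 // => i /negPf->.
  by rewrite sumrB -mulr_suml p1 mul1r subrr mulr0 subr0.
rewrite (eop_kmx_edge _ _ sm) (eop_kmx_edge _ _ (tnth_put_same _ _ _)).
by rewrite put_put subrr subr0.
Qed.

(** Constant coefficients along the edges form a multiple of the full cycle; at [v_j] the
    contributions of [e_(j - 1)] and [e_j] cancel. *)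
Lemma oop_dmx_eq0 m f s :
  (forall l, f (put s m (inr l)) = f (put s m (inr 0))) ->
  oop (dmx setT) m f s = 0.
Proof.
move=> fE; rewrite !ffunE; apply/eqP; rewrite mulf_eq0 signr_eq0 /=; apply/eqP.
rewrite big_site big1 ?add0r; last first.
  by move=> j _; case: (tnth s m) => ?; rewrite mul0r.
case: (tnth s m) => j; last by rewrite big1 // => i _; rewrite mul0r.
under eq_bigr => i _ do rewrite fE /= in_setT mul1r.
rewrite -mulr_suml sumrB (bigD1 (j - 1)) //= subrK eqxx big1; last first.
  by move=> l; rewrite -(inj_eq (addIr 1)) subrK => /negPf->.
rewrite (bigD1 j) //= eqxx big1; first by rewrite subrr mul0r.
by move=> i /negPf->.
Qed.

Lemma oop_dmx_projs0 p m ms f : m \in ms ->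
  oop (dmx setT) m (projs setT p ms f) = 0.
Proof.
elim: ms => //= l ms IH; rewrite inE.
have [->|ml] := eqVneq m l => /= [_|mms]; last first.
  by rewrite oop_proj ?IH ?raddf0 //; apply: sodd_dmx.
set g := projs _ _ _ _; apply/ffunP=> s; rewrite [RHS]ffunE.
have gE i : proj setT p l g (put s l (inr i)) = g (put s l (inr (p - 1))).
  rewrite 2!ffunE (eop_kmx_edge _ _ (tnth_put_same _ _ _)) put_put.
  by rewrite opprB addrC subrK.
by apply: oop_dmx_eq0 => i; rewrite !gE.
Qed.

(** The total projection commutes with [diff] and has image killed by [diff]; hence its coefficients
    are well defined on homology classes. *)
Lemma projs_diff0 p f : projs setT p (enum 'I_n) (diff setT f) = 0.
Proof.
rewrite -diff_projs /diff big1 // => m _.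
by rewrite oop_dmx_projs0 // mem_enum.
Qed.

End Differential.

(** * Support filtration *)

Section Acyclicity.

Variables n k : nat.

Local Notation tup := (n.-tuple (site k)).
Local Notation C := {ffun tup -> int}.

Implicit Types (s t : tup) (f g u : C) (m : 'I_n) (x y : site k).
Implicit Types (P S : {set 'Z_k}) (p : 'Z_k) (q : nat) (d : int).

(** This realizes every [C^{P,q}_d] as a subgroup of one fixed group, so that changing [P], [q] or
    [d] requires no cast. *)
Definition chain_on P q d f := forall s, f s != 0 -> is_cell P q d s.

Lemma chain_on0 P q d : chain_on P q d 0.
Proof. by move=> s; rewrite ffunE eqxx. Qed.

Lemma chain_onB P q d f g :
  chain_on P q d f -> chain_on P q d g -> chain_on P q d (f - g).
Proof.
move=> fC gC s; rewrite !ffunE.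
have [->|/fC//] := eqVneq (f s) 0; have [->|/gC//] := eqVneq (g s) 0.
by rewrite subrr eqxx.
Qed.

Lemma chain_onD P q d f g :
  chain_on P q d f -> chain_on P q d g -> chain_on P q d (f + g).
Proof.
move=> fC gC; rewrite -[g]opprK -[- g]sub0r; apply: chain_onB => //.
by apply: chain_onB => //; apply: chain_on0.
Qed.

Lemma chain_on_sum P q d (I : finType) (A : pred I) (F : I -> C) :
  (forall i, A i -> chain_on P q d (F i)) ->
  chain_on P q d (\sum_(i | A i) F i).
Proof.
move=> FC; elim/big_ind: _ => //; [exact: chain_on0 | exact: chain_onD].
Qed.

Lemma chain_on_sub P S q r d f : S \subset P -> (r <= q)%N ->
  chain_on S q d f -> chain_on P r d f.
Proof.
move=> SP rq fC s /fC/and3P[ds sS qs]; apply/and3P; split=> //.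
  exact: subset_trans sS SP.
exact: leq_trans rq qs.
Qed.

Lemma diffEn P f s : diff P f s != 0 -> exists m j l,
  [/\ tnth s m = inl j, j \in P & f (put s m (inr l)) != 0].
Proof.
rewrite sum_ffunE => nz.
have [m /oopEn[x []]|all0] := pickP (fun m => oop (dmx P) m f s != 0).
  case E: (tnth s m) => [j|//]; case: x => [?|l] //=.
  rewrite mulf_eq0 negb_or => /andP[jP _] nf; exists m, j, l; split=> //.
  by case: (j \in P) jP.
by move: nz; rewrite big1 ?eqxx // => m _; apply/eqP; rewrite -[_ == _]negbK all0.
Qed.

Lemma vedim_put_edge s m j l :
  tnth s m = inl j -> vedim (put s m (inr l)) = (vedim s).+1.
Proof. by move=> sm; have := vedim_put s m (inr l); rewrite sm addn0 addn1. Qed.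

(** Passing to a face never removes a vertex from the support and adds at most one, which lies in
    [P]. *)
Lemma chain_on_diff P q d f : chain_on P q (d + 1) f -> chain_on P q d (diff P f).
Proof.
move=> fC s /diffEn[m [j [l [sm jP /fC/and3P[ds sP qs]]]]].
have jS := vesupp_put_edgeK (inr l) sm.
apply/and3P; split.
- by move: ds; rewrite (vedim_put_edge l sm) -addn1 PoszD (inj_eq (addIr 1)).
- by apply: subset_trans jS _; rewrite subUset sub1set jP.
- by apply: leq_trans qs _; apply/subset_leq_card/vesupp_put_edge.
Qed.

(** Replacing a vertex by an edge can shrink the support, hence the restriction to [q = 0]. *)
Lemma chain_on_homotopy P p d m f :
  chain_on P 0 d f -> chain_on P 0 (d + 1) (oop (smx p) m f).
Proof.
move=> fC s /oopEn[x []]; case E: (tnth s m) => [//|l]; case: x => [j|//] _.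
case/fC/and3P=> ds sP _; apply/and3P; split=> //.
  (* The tuple [s] is viewed as the result of putting the edge [l] in place of the vertex [j]. *)
  rewrite -(put_id s m) E -(put_put s m (inl j)).
  rewrite (@vedim_put_edge _ m j) ?tnth_put_same //.
  by rewrite -addn1 PoszD (inj_eq (addIr 1)).
apply: subset_trans sP.
by rewrite -{1}(put_id s m) E -(put_put s m (inl j)) vesupp_put_edge.
Qed.

Lemma chain_on_projs P p d ms f : chain_on P 0 d f -> diff P f = 0 ->
  exists2 u, chain_on P 0 (d + 1) u & f - projs P p ms f = diff P u.
Proof.
move=> fC df; elim: ms => [|m ms [u uC uE]] /=.
  by exists 0; [exact: chain_on0 | rewrite subrr raddf0].
set g := projs P p ms f in uE *.
have dg : diff P g = 0 by rewrite diff_projs df raddf0.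
have gC : chain_on P 0 d g.
  rewrite -[g](subKr f) uE; apply: chain_onB => //.
  exact: chain_on_diff.
exists (u + oop (smx p) m g).
  by apply: chain_onD => //; apply: chain_on_homotopy.
rewrite [RHS]raddfD /= -uE /proj -diff_homotopy dg raddf0 addr0.
by rewrite opprB addrA addrAC.
Qed.

Lemma exists_vertex s : (vedim s < n)%N -> exists m j, tnth s m = inl j.
Proof.
move=> dn; have [m|all_e] := pickP (fun m => ~~ is_edge (tnth s m)).
  by case E: (tnth s m) => [j|//] _; exists m, j.
move: dn; rewrite /vedim (_ : [set _ | _] = setT) ?cardsT ?card_ord ?ltnn //.
by apply/setP=> m; rewrite !inE -[is_edge _]negbK all_e.
Qed.

(** With the base vertex outside [P], [kmx] is the identity on vertices of [P], so the projected
    cycle vanishes on tuples having a vertex entry; below degree [n] every tuple has one. *)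
Lemma proper_acyclic P p d f : p \notin P -> d < n%:Z ->
  chain_on P 0 d f -> diff P f = 0 ->
  exists2 u, chain_on P 0 (d + 1) u & diff P u = f.
Proof.
move=> pP dn fC df; have [u uC uE] := chain_on_projs p (enum 'I_n) fC df.
exists u => //; rewrite -uE; set g := projs _ _ _ _ in uE *.
suff -> : g = 0 by rewrite subr0.
have gC : chain_on P 0 d g.
  by rewrite -[g](subKr f) uE; apply: chain_onB => //; apply: chain_on_diff.
(* [N] is the diagonal projection onto the vertices of [P]. *)
pose N : smat k := fun x y =>
  if x is inl j then (j \in P)%:R * (y == inl j)%:R else 0.
have NK x z : smul N (kmx P p) x z = N x z.
  rewrite /smul; case: x => j /=; last by rewrite big1 // => y _; rewrite mul0r.
  rewrite (bigD1 (inl j)) //= eqxx mulr1 big1 ?addr0; last first.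
    by move=> y /negPf->; rewrite mulr0 mul0r.
  have [jP|] := boolP (j \in P); rewrite ?mul0r // !mul1r.
  case: z => i; last exact: kmx_lr.
  by rewrite kmx_ll jP mul1r (negPf (memPn pP _ jP)) subr0.
apply/ffunP=> s; rewrite ffunE; apply/eqP; apply: contraT => gs.
have /and3P[/eqP ds sP _] := gC s gs.
have [m [j sm]] : exists m j, tnth s m = inl j by apply: exists_vertex; lia.
have jP : j \in P by apply: (subsetP sP); rewrite inE -sm mem_tnth.
have /ffunP/(_ s) : eop N m g = 0.
  rewrite eop_projs0 ?mem_enum // => h; rewrite eop_eop; apply/ffunP=> t.
  by rewrite !ffunE; apply: eq_bigr => x _; rewrite NK.
rewrite eop_id => [g0|x]; first by rewrite g0 ffunE eqxx in gs.
by rewrite sm /= jP mul1r.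
Qed.

(** The value at [s] involves only tuples in which a vertex of [s] became an edge, and tests
    membership only for vertices of [s]. *)
Lemma eq_diff P S f g s :
  {in vesupp s, P =i S} -> (forall t, vesupp t \subset vesupp s -> f t = g t) ->
  diff P f s = diff S g s.
Proof.
move=> PS fg; rewrite !sum_ffunE; apply: eq_bigr => m _; apply: eq_oop => x.
case E: (tnth s m) => [j|j]; case: x => i; rewrite /= ?mul0r //.
by rewrite PS ?fg ?vesupp_put_edge // inE -E mem_tnth.
Qed.

Definition acyclic_support S := forall d f, d < n%:Z - #|S|%:Z ->
  chain_on S #|S| d f -> diff S f = 0 ->
  exists2 u, chain_on S #|S| (d + 1) u & diff S u = f.

(* The part of [f - D v] with support of size exactly [q] splits into cycles of
   the complexes [C^{S,q}], each of which bounds by hypothesis. *)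
Lemma raise_support P q d f :
  (forall S, S \proper P -> acyclic_support S) -> (q <= #|P|)%N ->
  d <= n%:Z - q%:Z -> chain_on P 0 d f -> chain_on P q (d - 1) (diff P f) ->
  exists2 u, chain_on P 0 (d + 1) u & chain_on P q d (f - diff P u).
Proof.
move=> acyc; elim: q => [|q IH] qP dq fC dfC.
  by exists 0; [exact: chain_on0 | rewrite raddf0 subr0].
have [||//|v vC gC] := IH _ _ fC; [exact: ltnW | lia | |].
  by apply: chain_on_sub dfC.
set g := f - diff P v in gC.
have dg : diff P g = diff P f by rewrite raddfB /= diff_diff subr0.
(* The condition on [S] sits under the existential so that fillings can be chosen for all [S] at
   once; the default is 0. *)
have fill S : exists u, (S \subset P) && (#|S| == q) ->
    chain_on S q (d + 1) u /\
    forall s, vesupp s = S -> diff S u s = g s.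
  case: (boolP (_ && _)) => [/andP[SP /eqP Sq]|_]; last by exists 0.
  pose h : C := [ffun s => if vesupp s == S then g s else 0].
  have hC : chain_on S #|S| d h.
    move=> s; rewrite ffunE; case: (vesupp s =P S) => [sS|]; last by rewrite eqxx.
    case/gC/and3P=> ds _ _.
    by rewrite /is_cell ds sS subxx leqnn.
  have dh : diff S h = 0.
    have dhC : chain_on S #|S| (d - 1) (diff S h).
      by apply: chain_on_diff; rewrite subrK.
    apply/ffunP=> s; rewrite ffunE; apply/eqP; apply: contraT => nz.
    have /and3P[_ sS Ss] := dhC s nz.
    have sSE : vesupp s = S by apply/eqP; rewrite eqEcard sS.
    (* A nonzero value would put [s], whose support has size [q], into the boundary of [f], where
       supports have size at least [q + 1]. *)
    suff E : diff S h s = diff P g s.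
      have : diff P f s != 0 by rewrite -dg -E.
      by case/dfC/and3P=> _ _; rewrite sSE Sq ltnn.
    apply: eq_diff => [j|t].
      by rewrite sSE => jS; rewrite jS (subsetP SP).
    rewrite sSE ffunE => tS; case: eqP => // tnS.
    apply/esym/eqP; apply: contraT => /gC/and3P[_ _ qt]; case: tnS.
    by apply/eqP; rewrite eqEcard tS Sq.
  have [||u uC uE] := acyc S _ d h _ hC dh.
  - by rewrite properEcard SP Sq.
  - by rewrite Sq; lia.
  exists u => _; split=> [|s sS]; first by rewrite -{1}Sq.
  by rewrite uE ffunE sS eqxx.
have [U UP] := fin_all_exists fill.
pose u := \sum_(S : {set 'Z_k} | (S \subset P) && (#|S| == q)) U S.
have uC : chain_on P q (d + 1) u.
  apply: chain_on_sum => S SPq; have [SC _] := UP S SPq.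
  by apply: chain_on_sub SC => //; case/andP: SPq.
exists (v + u).
  by apply: chain_onD => //; apply: chain_on_sub uC.
rewrite raddfD /= opprD addrA -/g; clearbody g => s nz.
have /and3P[ds sP qs] : is_cell P q d s.
  by move: s nz; apply: chain_onB => //; apply: chain_on_diff.
rewrite /is_cell ds sP /= ltn_neqAle qs andbT; apply: contra nz => /eqP sq.
have sPq : (vesupp s \subset P) && (#|vesupp s| == q) by rewrite sP sq eqxx.
rewrite !ffunE subr_eq0 eq_sym; have [_ <-//] := UP _ sPq.
rewrite raddf_sum sum_ffunE (bigD1 (vesupp s)) //= big1 ?addr0 => [|S].
  by apply/eqP/eq_diff => // j js; rewrite js (subsetP sP).
(* A tuple of [U S] with face [s] has support equal to [S] and contained in that of [s]; both have
   size [q], which forces [S] to be the support of [s]. *)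
case/andP=> SPq Ss; have [SC _] := UP S SPq; apply/eqP; apply: contraT.
case/diffEn=> m [j [l [_ _ /SC/and3P[_ tS qt]]]]; case/eqP: Ss.
have ts := vesupp_put_edge s m (isT : is_edge (inr l : site k)).
case/andP: SPq => _ /eqP Sq.
have /eqP <- : vesupp (put s m (inr l)) == S by rewrite eqEcard tS Sq.
by apply/eqP; rewrite eqEcard ts -sq.
Qed.

(** A cycle is first filled without any support condition, then [raise_support] in degree [d + 1]
    corrects the filling by a boundary, which leaves its differential unchanged. The smaller
    supports are handled by induction on [#|S|]. *)
Lemma support_acyclic S : S != setT -> acyclic_support S.
Proof.
elim: {S}#|S|.+1 {-2}S (ltnSn #|S|) => // c IH S Sc SnT d f dS fC df.
have [p _ pS] : exists2 p, p \in setT & p \notin S.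
  by apply/subsetPn; rewrite subTset.
have [||u uC uE] := @proper_acyclic S p d f pS _ _ df; first by lia.
  by apply: chain_on_sub fC.
have [|||v vC vE] := @raise_support S #|S| (d + 1) u _ (leqnn _) _ uC.
- move=> T TS; apply: IH; first exact: leq_trans (proper_card TS) Sc.
  by apply: contraTneq TS => ->; rewrite properE subsetT andbF.
- by lia.
- by rewrite addrK uE.
exists (u - diff S v) => //.
by rewrite raddfB /= diff_diff subr0.
Qed.

End Acyclicity.

(** * Chains as functions on all tuples *)

Local Open Scope quotient_scope.

(** A map defined on all chains descends to homology when it kills boundaries; bijectivity then only
    has to be checked on cycles. *)
Lemma homology_isomorphic (A B C V : zmodType) (f : {additive A -> B})
    (g : {additive B -> C}) (phi : {additive B -> V}) :
  (forall x, phi (f x) = 0) ->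
  (forall z, g z = 0 -> phi z = 0 -> exists x, f x = z) ->
  (forall v, exists2 z, g z = 0 & phi z = v) ->
  zmod_isomorphic (homology f g) V.
Proof.
move=> phi_bnd phi_inj phi_surj.
pose psi (x : homology f g) : V := phi (val (repr x)).
have psi_pi (z : cycles g) : psi (\pi z) = phi (val z).
  apply/eqP; rewrite -subr_eq0 -!raddfB /=.
  have : repr (\pi_(homology f g) z) - z \in is_boundary f g.
    by rewrite Quotient.idealrBE reprK.
  rewrite inE => /asboolP[x xE]; apply/eqP; rewrite -(phi_bnd x); congr (phi _).
  exact/esym.
have piB (z w : cycles g) : \pi_(homology f g) z - \pi_(homology f g) w
    = \pi_(homology f g) (z - w) :> homology f g.
  by rewrite !piE.
have psiB : zmod_morphism psi.
  move=> x y; rewrite -[x]reprK -[y]reprK piB !psi_pi.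
  by rewrite -raddfB; congr (phi _); rewrite raddfB.
pose psiM := GRing.isZmodMorphism.Build _ _ psi psiB.
pose Psi : {additive homology f g -> V} := HB.pack psi psiM.
exists Psi => /=.
have psi_inj : injective psi.
  move=> x y /eqP; rewrite -subr_eq0 -psiB -[x]reprK -[y]reprK piB psi_pi.
  move=> /eqP z0; apply/eqP; rewrite -Quotient.idealrBE inE; apply/asboolP.
  apply: phi_inj => //; apply/eqP; exact: valP (repr x - repr y).
have psi_surj v : exists x, psi x = v.
  have [z gz <-] := phi_surj v.
  have zc : z \in is_cycle g by rewrite inE gz.
  by exists (\pi_(homology f g) (Cycle zc)); rewrite psi_pi.
have [h hK] := choice psi_surj.
by exists h => // x; apply: psi_inj; rewrite hK.
Qed.

Section Extension.

Variables n k : nat.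

Local Notation tup := (n.-tuple (site k)).
Local Notation C := {ffun tup -> int}.

Implicit Types (s t : tup) (f g u : C) (m : 'I_n) (x y : site k).
Implicit Types (P S : {set 'Z_k}) (p : 'Z_k) (q : nat) (d : int).

Definition extend P q d (c : chain n P q d) : C :=
  [ffun s => if insub s is Some t then c t else 0].

Definition restrict P q d f : chain n P q d := [ffun t => f (val t)].

Fact extend_is_zmod_morphism P q d : zmod_morphism (@extend P q d).
Proof.
by move=> b c; apply/ffunP=> s; rewrite !ffunE; case: insub => [t|];
  rewrite ?ffunE ?subr0.
Qed.

HB.instance Definition _ P q d := GRing.isZmodMorphism.Build (chain n P q d) C
  (@extend P q d) (@extend_is_zmod_morphism P q d).

Lemma extendE P q d (c : chain n P q d) (t : cell n P q d) :
  extend c (val t) = c t.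
Proof. by rewrite ffunE valK. Qed.

Lemma chain_on_extend P q d (c : chain n P q d) : chain_on P q d (extend c).
Proof. by move=> s; rewrite ffunE; case: insubP => // _; rewrite eqxx. Qed.

Lemma extend_restrict P q d f :
  chain_on P q d f -> extend (restrict P q d f) = f.
Proof.
move=> fC; apply/ffunP=> s; rewrite ffunE; case: insubP => [t _ <-|ns].
  by rewrite ffunE.
by apply/esym/eqP; apply: contraNT ns => /fC.
Qed.

(** [boundary] sums over the faces of each cell, while [diff] collects the coefficients at a given
    face. They agree because the tuples with face [t] in direction [m] differ from [t] only at
    [m]. *)
Lemma boundaryE P q d d' (c : chain n P q d) (t : cell n P q d') :
  boundary d' c t = diff P (extend c) (val t).
Proof.
rewrite /boundary sum_ffunE /diff [RHS]sum_ffunE.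
pose B s m : int := if tnth s m is inr j then
  (-1) ^+ verho s m *
    ((j + 1 \in P)%:R * (val t == put s m (inl (j + 1)))%:R
     - (j \in P)%:R * (val t == put s m (inl j))%:R) else 0.
transitivity (\sum_s (\sum_m B s m) * extend c s).
  rewrite [RHS](bigID (is_cell P q d)) /= [X in _ + X]big1 ?addr0; last first.
    by move=> s ns; rewrite ffunE insubN // mulr0.
  rewrite [RHS](@reindex_omap _ _ _ _ (cell n P q d) val insub) /=; last first.
    by move=> s cs; rewrite insubT.
  apply: eq_big => [s|s _]; first by rewrite valK eqxx andbT (valP s).
  rewrite extendE ffunMzE -mulrzr intz; congr (_ * _).
  rewrite sum_ffunE; apply: eq_bigr => m _; rewrite /B.
  case: (tnth _ _) => j; first by rewrite ffunE.
  rewrite ffunMzE -mulrzr intz mulrC !ffunE; congr (_ * (_ - _)).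
    by case: ifP; rewrite !ffunE ?mul1r ?mul0r.
  by case: ifP; rewrite !ffunE ?mul1r ?mul0r.
rewrite (eq_bigr _ (fun s _ => mulr_suml _ _ _ _)) exchange_big.
apply: eq_bigr => m _.
(* Once the entry [x] at [m] is fixed, only [put (val t) m x] can have [t] as a face in direction
   [m]. *)
rewrite (partition_big (fun s => tnth s m) predT) //= !ffunE mulr_sumr.
apply: eq_bigr => x _.
rewrite (bigD1 (put (val t) m x)) ?tnth_put_same //= big1 ?addr0; last first.
  move=> s /andP[/eqP sm st]; rewrite /B.
  have ne i : (val t == put s m (inl i)) = false.
    apply: contraNF st => /eqP->; rewrite put_put -sm put_id; exact: eqxx.
  by case: (tnth s m) => i; rewrite ?ne ?mulr0 ?subrr ?mulr0 mul0r.
rewrite mulrA; congr (_ * _); rewrite /B tnth_put_same verho_put_same.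
have pE i : (val t == put (put (val t) m x) m (inl i)) = (tnth (val t) m == inl i).
  rewrite put_put; apply/eqP/eqP => [->|<-]; first by rewrite tnth_put_same.
  by rewrite put_id.
case: x pE => l pE; first by case: (tnth _ _) => ?; rewrite mulr0.
rewrite !pE; congr (_ * _); case: (tnth _ _) => j /=; last by rewrite !mulr0 subrr.
rewrite -![inl _ == inl _]/(j == _) ![j == _]eq_sym mulrBr.
by congr (_ - _); case: eqP => [->|_]; rewrite ?mulr0.
Qed.

End Extension.

(** * Homology of the torus *)

Section Torus.

Variables n k : nat.

Local Notation tup := (n.-tuple (site k)).
Local Notation C := {ffun tup -> int}.

Implicit Types (s t : tup) (f g u : C) (m : 'I_n) (x y : site k).
Implicit Types (q : nat) (d : int) (I : {set 'I_n}).

Local Notation proj_all := (projs setT (0 : 'Z_k) (enum 'I_n)).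
Local Notation K := (kmx setT (0 : 'Z_k)).

Definition edge_set s : {set 'I_n} := [set m | is_edge (tnth s m)].

(** One marked cell of the coordinate subtorus of directions [I]; the edge [0 - 1] is the reference
    edge [p - 1] of [eop_kmx_edge] for [p = 0]. *)
Definition subtorus I : tup := [tuple if m \in I then inr (0 - 1) else inl 0 | m < n].

Lemma edge_set_subtorus I : edge_set (subtorus I) = I.
Proof. by apply/setP=> m; rewrite inE tnth_mktuple; case: (m \in I). Qed.

(** Being killed by every [K] means being constant along the edges of each coordinate and zero when
    a vertex entry is not [v_0], so the values at the marked cells determine [f]. *)
Lemma normal_form_eq0 f : (forall m, eop K m f = 0) ->
  (forall s, f s != 0 -> f (subtorus (edge_set s)) = 0) -> f = 0.
Proof.
move=> Kf f0; apply/ffunP=> s; rewrite [RHS]ffunE.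
have f_edge m t l : tnth t m = inr l -> f t = f (put t m (inr (0 - 1))).
  move=> tm; have /ffunP/(_ t) := Kf m; rewrite (eop_kmx_edge _ _ tm) ffunE.
  by move/eqP; rewrite subr_eq0 => /eqP.
have f_vertex m t j : tnth t m = inl j -> j != 0 -> f t = 0.
  move=> tm /negPf j0; have /ffunP/(_ t) := Kf m.
  by rewrite (eop_kmx_vertex _ _ tm) ffunE j0 mul0r subr0.
apply/eqP; apply: contraT => fs.
(* The edges are moved to the reference edge one coordinate at a time, without changing the value of
   [f]. *)
pose shift (ms : seq 'I_n) : tup :=
  [tuple if (m \in ms) && is_edge (tnth s m) then inr (0 - 1) else tnth s m | m < n].
have shiftE ms : f s = f (shift ms).
  elim: ms => [|m ms ->].
    by congr (f _); apply: eq_from_tnth => m; rewrite tnth_mktuple.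
  have [em|em] := boolP (is_edge (tnth s m)); last first.
    congr (f _); apply: eq_from_tnth => l; rewrite !tnth_mktuple inE.
    by case: eqP => [->|//]; rewrite (negPf em) !andbF.
  have [l sl] : exists l, tnth (shift ms) m = inr l.
    rewrite tnth_mktuple em andbT; case: ifP => _; first by exists (0 - 1).
    by case: (tnth s m) em => // l; exists l.
  rewrite (f_edge _ _ _ sl); congr (f _); apply: eq_from_tnth => i.
  by rewrite tnth_put !tnth_mktuple inE; case: eqP => // ->; rewrite em.
move: (fs); rewrite (shiftE (enum 'I_n)).
rewrite (_ : shift _ = subtorus (edge_set s)) ?f0 ?eqxx //.
apply: eq_from_tnth => m; rewrite !tnth_mktuple mem_enum [m \in edge_set s]inE /=.
case sm: (tnth s m) => [j|//] /=; have [->//|j0] := eqVneq j 0.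
by move: fs; rewrite (f_vertex _ _ _ sm j0) eqxx.
Qed.

(** The combination, with weights [w], of the fundamental cycles of the coordinate subtori through
    [v_0]. *)
Definition subtorus_chain (w : {set 'I_n} -> int) : C :=
  [ffun s => if [forall m, is_edge (tnth s m) || (tnth s m == inl 0)]
             then w (edge_set s) else 0].

Lemma subtorus_chain_put_edge w s m l :
  subtorus_chain w (put s m (inr l)) = subtorus_chain w (put s m (inr 0)).
Proof.
have e i : is_edge (tnth (put s m (inr l)) i) = is_edge (tnth (put s m (inr 0)) i).
  by rewrite !tnth_put; case: eqP.
rewrite !ffunE; congr (if _ then w _ else _); last by apply/setP=> i; rewrite !inE e.
by apply: eq_forallb => i; rewrite e !tnth_put; case: eqP.
Qed.

Lemma diff_subtorus_chain w : diff setT (subtorus_chain w) = 0.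
Proof.
apply/ffunP=> s; rewrite sum_ffunE [RHS]ffunE big1 // => m _.
by apply: oop_dmx_eq0 => l; apply: subtorus_chain_put_edge.
Qed.

Lemma subtorus_chain_put_vertex w s m j :
  j != 0 -> subtorus_chain w (put s m (inl j)) = 0.
Proof.
move=> j0; rewrite ffunE; case: forallP => // /(_ m).
by rewrite tnth_put_same /= => /eqP[jE]; rewrite jE eqxx in j0.
Qed.

Lemma eop_subtorus_chain w m : eop K m (subtorus_chain w) = 0.
Proof.
apply/ffunP=> s; rewrite [RHS]ffunE; set g := subtorus_chain w.
case sm: (tnth s m) => [j|l]; last first.
  rewrite (eop_kmx_edge _ _ sm) -{1}(put_id s m) sm /g.
  by rewrite subtorus_chain_put_edge [X in _ - X]subtorus_chain_put_edge subrr.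
rewrite (eop_kmx_vertex _ _ sm) (bigD1 0) //= big1 ?addr0; last first.
  by move=> i; apply: subtorus_chain_put_vertex.
rewrite -{1}(put_id s m) sm; have [->|j0] := eqVneq j 0.
  by rewrite mul1r subrr.
by rewrite mul0r subr0 /g subtorus_chain_put_vertex.
Qed.

Lemma projs_subtorus_chain w ms :
  projs setT 0 ms (subtorus_chain w) = subtorus_chain w.
Proof.
by elim: ms => //= m ms ->; rewrite /proj eop_subtorus_chain subr0.
Qed.

Lemma subtorus_chainE w I : subtorus_chain w (subtorus I) = w I.
Proof.
rewrite ffunE ifT ?edge_set_subtorus //.
by apply/forallP=> m; rewrite tnth_mktuple; case: ifP.
Qed.

Lemma projs_normal m f : eop K m (proj_all f) = 0.
Proof. by apply: eop_projs0; [exact: eop_kmx_idem | rewrite mem_enum]. Qed.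

End Torus.

(** * Coordinates on homology indexed by the subtori of dimension [r] *)

Section Homology.

Variables n k q r : nat.

Local Notation tup := (n.-tuple (site k)).
Local Notation C := {ffun tup -> int}.
Local Notation proj_all := (projs setT (0 : 'Z_k) (enum 'I_n)).
Local Notation chn d := (chain n [set: 'Z_k] q d).

Implicit Types (c : chn r%:Z) (d : int) (I : {set 'I_n}).

Lemma card_sets : 'C(n, r) = #|[set I : {set 'I_n} | #|I| == r]|.
Proof. by rewrite card_draws card_ord. Qed.

Definition nth_set (j : 'I_('C(n, r))) : {set 'I_n} :=
  enum_val (cast_ord card_sets j).

Lemma nth_set_inj : injective nth_set.
Proof. by move=> i j /enum_val_inj/cast_ord_inj. Qed.

Lemma card_nth_set j : #|nth_set j| = r.
Proof. by have := enum_valP (cast_ord card_sets j); rewrite inE => /eqP. Qed.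

Lemma nth_setP I : #|I| = r -> exists j, nth_set j = I.
Proof.
move=> Ir; have IA : I \in [set I : {set 'I_n} | #|I| == r] by rewrite inE Ir.
exists (cast_ord (esym card_sets) (enum_rank_in IA I)).
by rewrite /nth_set cast_ordKV enum_rankK_in.
Qed.

Definition subtorus_coords c : 'rV[int]_('C(n, r)) :=
  \row_j proj_all (extend c) (subtorus k (nth_set j)).

Fact subtorus_coords_is_zmod_morphism : zmod_morphism subtorus_coords.
Proof.
by move=> b c; apply/rowP=> j; rewrite !mxE !raddfB /= !ffunE.
Qed.

HB.instance Definition _ :=
  GRing.isZmodMorphism.Build (chn r%:Z) 'rV[int]_('C(n, r)) subtorus_coords
    subtorus_coords_is_zmod_morphism.

Lemma extend_boundary d d' (b : chn d) : d = d' + 1 ->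
  extend (boundary d' b : chn d') = diff setT (extend b).
Proof.
move=> dE; rewrite -[RHS](@extend_restrict _ _ setT q d').
  by congr extend; apply/ffunP=> t; rewrite boundaryE ffunE.
by apply: chain_on_diff; rewrite -dE; apply: chain_on_extend.
Qed.

Lemma extend_inj d : injective (@extend n k setT q d).
Proof. by move=> b c bc; apply/ffunP=> t; rewrite -!extendE bc. Qed.

Lemma raise_support_torus d (f : C) : (q <= #|[set: 'Z_k]|)%N ->
  d <= n%:Z - q%:Z -> chain_on setT 0 d f ->
  chain_on setT q (d - 1) (diff setT f) ->
  exists2 u : C, chain_on setT 0 (d + 1) u & chain_on setT q d (f - diff setT u).
Proof.
move=> qk dq; apply: raise_support => // S; rewrite properT.
exact: support_acyclic.
Qed.

Lemma homology_torus : (q <= #|[set: 'Z_k]|)%N -> r%:Z <= n%:Z - q%:Z - 1 ->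
  zmod_isomorphic (complex_homology n [set: 'Z_k] q r%:Z) 'rV[int]_('C(n, r)).
Proof.
move=> qk rq; apply: (homology_isomorphic (phi := subtorus_coords)).
- move=> b; apply/rowP=> j; rewrite !mxE /= extend_boundary //.
  by rewrite projs_diff0 ffunE.
- move=> z /= bz z0.
  have dz : diff setT (extend z) = 0.
    by rewrite -(@extend_boundary _ (r%:Z - 1)) ?subrK // bz raddf0.
  have zC : chain_on setT 0 r%:Z (extend z).
    by apply: chain_on_sub (subxx _) (leq0n q) _; apply: chain_on_extend.
  have [u uC] := chain_on_projs 0 (enum 'I_n) zC dz.
  set g := proj_all _ => uE.
  have gC : chain_on setT 0 r%:Z g.
    rewrite -[g](subKr (extend z)) uE; apply: chain_onB => //.
    exact: chain_on_diff.
  have g0 : g = 0.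
    apply: normal_form_eq0 => [m|s /gC/and3P[/eqP[ds] _ _]]; first exact: projs_normal.
    have [j <-] : exists j, nth_set j = edge_set s by apply: nth_setP.
    by move/rowP/(_ j): z0; rewrite !mxE.
  rewrite g0 subr0 in uE.
  (* The filling [u] has degree [r + 1], which must not exceed [n - q]; this is where the bound on
     [r] comes from. *)
  have [||v vC uvC] := raise_support_torus qk _ uC; first by lia.
    by rewrite addrK -uE; apply: chain_on_extend.
  exists (restrict setT q (r%:Z + 1) (u - diff setT v)).
  apply: extend_inj; rewrite extend_boundary // extend_restrict //.
  by rewrite raddfB /= diff_diff subr0.
- move=> v.
  (* The value 0 on sets that are not of size [r] makes the resulting chain homogeneous of degree
     [r]. *)
  pose w I := if [pick j | nth_set j == I] is Some j then v 0 j else 0.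
  pose g : C := subtorus_chain k w.
  have dg : diff setT g = 0 := diff_subtorus_chain k w.
  have gC : chain_on setT 0 r%:Z g.
    move=> s; rewrite ffunE; case: forallP => [_|]; last by rewrite eqxx.
    rewrite /w; case: pickP => [j /eqP jE _|]; last by rewrite eqxx.
    by rewrite /is_cell subsetT andbT -(card_nth_set j) jE.
  have [||u uC guC] := raise_support_torus qk _ gC; first by lia.
    by rewrite dg; apply: chain_on0.
  exists (restrict setT q r%:Z (g - diff setT u)).
    apply: extend_inj; rewrite extend_boundary ?subrK // extend_restrict //.
    by rewrite raddfB /= dg diff_diff subrr raddf0.
  (* The correction by [diff setT u] is invisible to the coordinates, since the projection kills
     boundaries. *)
  apply/rowP=> j; rewrite !mxE extend_restrict // raddfB /= projs_diff0 subr0.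
  rewrite projs_subtorus_chain subtorus_chainE /w.
  by case: pickP => [i /eqP/nth_set_inj->//|/(_ j)]; rewrite eqxx.
Qed.

End Homology.

(** * Degrees without cells *)

Lemma vedim_add_card_vesupp (n k : nat) (s : n.-tuple (site k)) :
  (vedim s + #|vesupp s| <= n)%N.
Proof.
apply: (@leq_trans (vedim s + #|~: edge_set s|)); last by rewrite cardsC card_ord.
(* Each vertex of the support occupies some non-edge coordinate, so [h] maps those coordinates onto
   a superset of the support. *)
rewrite leq_add2l; pose h m : 'Z_k := if tnth s m is inl j then j else 0.
apply: leq_trans (leq_imset_card h _); apply/subset_leq_card/subsetP=> j.
rewrite inE => /tnthP[m sm]; apply/imsetP; exists m; first by rewrite !inE -sm.
by rewrite /h -sm.
Qed.

Lemma homology_out_of_range (n k q : nat) (P : {set 'Z_k}) (i : int) :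
  i < 0 \/ n%:Z - q%:Z < i -> forall x : complex_homology n P q i, x = 0.
Proof.
move=> iP x; rewrite -[x]reprK.
suff -> : repr x = 0 by rewrite !piE.
(* A generator would have dimension between 0 and [n - q], so the chain group is trivial in this
   degree. *)
apply/val_inj/ffunP=> -[s sC]; case/and3P: (sC) => /eqP di _ qs.
by have := vedim_add_card_vesupp s; lia.
Qed.

Theorem theorem4p4 (n k q : nat) (i : int) :
  (2 <= k)%N -> (k <= n)%N -> (q <= k)%N ->
  (0 <= i <= n%:Z - q%:Z - 1 ->
     zmod_isomorphic (complex_homology n [set: 'Z_k] q i)
                     'rV[int]_('C(n, `|i|%N))) /\
  (i < 0 \/ n%:Z - q%:Z < i ->
     forall x : complex_homology n [set: 'Z_k] q i, x = 0).
Proof.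
move=> k2 _ qk; split; last exact: homology_out_of_range.
case: i => [r|r] /andP[// _ rq]; apply: homology_torus => //.
by rewrite cardsT card_ord Zp_cast.
Qed.
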